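(* For every non-negative integer $N$, \[\sum_{\pi\in\mathcal{D}_{\le N}} q^{\mathcal{O}(\pi)} = \sum_{i=0}^N {N\brack i}_q q^i,\qquad \sum_{\pi\in\mathcal{P}_{\le N}} q^{\mathcal{O}(\pi)} = \sum_{i=0}^N \frac{q^i}{(q;q)_i(q;q)_{N-i}}.\]
   Context: A partition $\pi=(\lambda_1,\lambda_2,\dots)$ is a finite non-increasing sequence of positive integers; the empty sequence is the unique partition of $0$. $\mathcal{P}_{\le N}$ is the set of partitions with all parts $\le N$, $\mathcal{D}_{\le N}$ the set of partitions into distinct parts all $\le N$. $\mathcal{O}(\pi)=\lambda_1+\lambda_3+\lambda_5+\cdots$. $(a;q)_l=\prod_{i=0}^{l-1}(1-aq^i)$ and ${n+m\brack n}_q=\frac{(q;q)_{n+m}}{(q;q)_n(q;q)_m}$ for $n,m\ge0$, $0$ otherwise. Identities of formal power series in $q$. *)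

(* Defs.v *)
From HB Require Import structures.
From mathcomp Require Import all_boot all_order all_algebra.
From mathcomp Require Import boolp.

Set Implicit Arguments.
Unset Strict Implicit.
Unset Printing Implicit Defensive.

Import GRing.Theory.
Local Open Scope ring_scope.

(* Formal power series: [f n] is the coefficient of q^n.  A record rather than
   a bare function type, which would inherit the pointwise ring structure. *)
Record fps (R : Type) := FPS { fps_coef : nat -> R }.
Coercion fps_coef : fps >-> Funclass.
Notation "{ 'fps' R }" := (fps R) (at level 0, format "{ 'fps'  R }").

HB.instance Definition _ (R : Type) := gen_eqMixin {fps R}.
HB.instance Definition _ (R : Type) := gen_choiceMixin {fps R}.

Lemma fpsP (R : Type) (f g : {fps R}) : (forall n, f n = g n) -> f = g.
Proof. by case: f g => [f] [g] /= fg; congr FPS; apply: funext. Qed.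

Section FpsZmod.
Variable R : zmodType.
Implicit Types f g h : {fps R}.

Definition fps_zero : {fps R} := FPS (fun=> 0).
Definition fps_opp f := FPS (fun n => - f n).
Definition fps_add f g := FPS (fun n => f n + g n).

Fact fps_addA : associative fps_add.
Proof. by move=> f g h; apply: fpsP => n /=; rewrite addrA. Qed.
Fact fps_addC : commutative fps_add.
Proof. by move=> f g; apply: fpsP => n /=; rewrite addrC. Qed.
Fact fps_add0 : left_id fps_zero fps_add.
Proof. by move=> f; apply: fpsP => n /=; rewrite add0r. Qed.
Fact fps_addN : left_inverse fps_zero fps_opp fps_add.
Proof. by move=> f; apply: fpsP => n /=; rewrite addNr. Qed.

HB.instance Definition _ :=
  GRing.isZmodule.Build {fps R} fps_addA fps_addC fps_add0 fps_addN.
End FpsZmod.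

Section FpsRing.
Variable R : comNzRingType.
Implicit Types f g h : {fps R}.

Definition fps_one : {fps R} := FPS (fun n => (n == 0%N)%:R).
Definition fps_mul f g := FPS (fun n => \sum_(i < n.+1) f i * g (n - i)%N).
Definition fpsX : {fps R} := FPS (fun n => (n == 1%N)%:R).

Definition fps_trunc n f : {poly R} := \poly_(i < n.+1) f i.

Lemma coef_fps_trunc n f k : (k <= n)%N -> (fps_trunc n f)`_k = f k.
Proof. by move=> le_kn; rewrite coef_poly ltnS le_kn. Qed.

Lemma fps_mulE n f g k : (k <= n)%N ->
  fps_mul f g k = (fps_trunc n f * fps_trunc n g)`_k.
Proof.
move=> le_kn; rewrite coefM; apply: eq_bigr => i _.
rewrite !coef_fps_trunc //; first exact: leq_trans (leq_subr _ _) le_kn.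
by apply: leq_trans le_kn; rewrite -ltnS.
Qed.

Fact fps_mulC : commutative fps_mul.
Proof. by move=> f g; apply: fpsP => n; rewrite !(@fps_mulE n) // mulrC. Qed.

Fact fps_mulA : associative fps_mul.
Proof.
move=> f g h; apply: fpsP => n.
transitivity (fps_trunc n f * (fps_trunc n g * fps_trunc n h))`_n.
  rewrite coefM; apply: eq_bigr => i _.
  by rewrite (@fps_mulE n) ?leq_subr // coef_fps_trunc // -ltnS.
rewrite mulrA coefM; apply: eq_bigr => i _.
by rewrite (@fps_mulE n) ?coef_fps_trunc ?leq_subr // -ltnS.
Qed.

Fact fps_mul1 : left_id fps_one fps_mul.
Proof.
move=> f; apply: fpsP => n /=.
by rewrite big_ord_recl big1 ?subn0 ?mul1r ?addr0 // => i _; rewrite mul0r.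
Qed.

Fact fps_mulDl : left_distributive fps_mul +%R.
Proof.
move=> f g h; apply: fpsP => n /=; rewrite -big_split /=.
by apply: eq_bigr => i _; rewrite mulrDl.
Qed.

Fact fps_one_neq0 : fps_one != 0.
Proof.
apply/eqP => /(congr1 (fun f : {fps R} => f 0%N)) /= /eqP.
by rewrite oner_eq0.
Qed.

HB.instance Definition _ := GRing.Zmodule_isComNzRing.Build {fps R}
  fps_mulA fps_mulC fps_mul1 fps_mulDl fps_one_neq0.
End FpsRing.

Section FpsUnit.
Variable R : comUnitRingType.
Implicit Types f g h : {fps R}.

Definition fps_unit : {pred {fps R}} := fun f => f 0%N \is a GRing.unit.

(* The first [n] coefficients of the inverse [g] of [f], obtained by solving
   [\sum_(j < m.+1) g j * f (m - j) = (m == 0)%:R] for [g m]. *)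
Fixpoint fps_inv_seq f n : seq R :=
  if n is m.+1 then
    let s := fps_inv_seq f m in
    rcons s (((m == 0%N)%:R - \sum_(j < m) s`_j * f (m - j)%N) / f 0%N)
  else [::].

Definition fps_inv f :=
  if fps_unit f then FPS (fun n => (fps_inv_seq f n.+1)`_n) else f.

Lemma size_fps_inv_seq f n : size (fps_inv_seq f n) = n.
Proof. by elim: n => //= n IHn; rewrite size_rcons IHn. Qed.

Lemma nth_fps_inv_seq f n k :
  (k < n)%N -> (fps_inv_seq f n)`_k = (fps_inv_seq f k.+1)`_k.
Proof.
elim: n => // n IHn; rewrite ltnS leq_eqVlt => /predU1P[-> // | lt_kn].
by rewrite {1}/fps_inv_seq -/fps_inv_seq nth_rcons size_fps_inv_seq lt_kn IHn.
Qed.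

Fact fps_mulVx : {in fps_unit, left_inverse 1 fps_inv *%R}.
Proof.
move=> f Uf; apply: fpsP => n.
rewrite /fps_inv (Uf : fps_unit f = true).
rewrite [LHS]/= big_ord_recr /= subnn.
rewrite nth_rcons size_fps_inv_seq ltnn eqxx divrK // addrCA.
rewrite -sumrB big1 ?addr0 // => i _.
by rewrite nth_fps_inv_seq ?subrr.
Qed.

Fact fps_unitPl f g : g * f = 1 -> fps_unit f.
Proof.
move/(congr1 (fun h : {fps R} => h 0%N)); rewrite /= big_ord1 subnn => gf1.
by apply/unitrPr; exists (g 0%N); rewrite mulrC.
Qed.

Fact fps_invr_out : {in [predC fps_unit], fps_inv =1 id}.
Proof. by move=> f /negPf nUf; rewrite /fps_inv [fps_unit f]nUf. Qed.

HB.instance Definition _ := GRing.ComNzRing_hasMulInverse.Build {fps R}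
  fps_mulVx fps_unitPl fps_invr_out.
End FpsUnit.

Arguments fpsX {R}.

(* The family (f i), i in A, is summable in the formal (coefficientwise) sense
   and has sum F: for each n only finitely many members have a nonzero
   coefficient of q^n, and those coefficients add up to that of F. *)
Definition fps_has_sum (R : zmodType) (I : eqType) (A : {pred I})
    (f : I -> {fps R}) (F : {fps R}) : Prop :=
  forall n, exists s : seq I,
    [/\ uniq s, forall i, (i \in s) = (i \in A) && (f i n != 0)
      & F n = \sum_(i <- s) f i n].

Section QSeries.
Variable R : comUnitRingType.
Local Notation q := (fpsX : {fps R}).

Definition qpoch (a : {fps R}) (l : nat) : {fps R} :=
  \prod_(i < l) (1 - a * q ^+ i).

(* So the divisions by (q;q)_l below are genuine ones. *)
Lemma qpochX_unit l : qpoch q l \is a GRing.unit.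
Proof.
rewrite /qpoch; apply: rpred_prod => i _.
change ((1 - q * q ^+ i) 0%N \is a GRing.unit).
by rewrite /= big_ord1 mul0r subr0 unitr1.
Qed.

Definition qbinom (N i : nat) : {fps R} :=
  if (i <= N)%N then qpoch q N / (qpoch q i * qpoch q (N - i)) else 0.
End QSeries.

Arguments qpoch {R}.
Arguments qbinom {R}.

Definition is_partition (s : seq nat) : bool :=
  sorted geq s && all (fun k => 0 < k)%N s.

Definition partitions_le (N : nat) : {pred seq nat} :=
  [pred s | is_partition s && all (fun k => k <= N)%N s].

Definition distinct_partitions_le (N : nat) : {pred seq nat} :=
  [pred s | [&& is_partition s, uniq s & all (fun k => k <= N)%N s]].

(* lambda_1 + lambda_3 + ...: the parts with even index when counted from 0. *)
Definition odd_index_sum (s : seq nat) : nat :=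
  (\sum_(i < size s | ~~ odd i) nth 0 s i)%N.

(* Main.v *)
Require Import Defs.
From mathcomp Require Import all_boot all_order all_algebra.
From mathcomp Require Import zify ring.

(** Write [O] and [E] for the sums of the parts at odd and at even positions,
    and let [A_N], [B_N] be the generating functions of [q^O], [q^E] over the
    partitions considered. Prepending a part exchanges the two statistics, so
    sorting by whether the largest part equals [N+1] gives
    [A_(N+1) = A_N + q^(N+1) B_N] and [B_(N+1) = B_N + A_N] for distinct parts;
    for unrestricted parts [B_N] and [A_N] in the last summands become
    [B_(N+1)] and [A_(N+1)].
    With [c_i = 1 / ((q;q)_i (q;q)_(N-i))], the series [\sum_i q^i c_i] and
    [\sum_i c_i] satisfy the unrestricted recurrences because
    [(1 - q^i) / (q;q)_i = 1 / (q;q)_(i-1)]; multiplying both by [(q;q)_N]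
    yields solutions of the recurrences for distinct parts. *)

Set Implicit Arguments.
Unset Strict Implicit.
Unset Printing Implicit Defensive.

Import GRing.Theory.
Local Open Scope ring_scope.

Section QSums.
Variable R : comUnitRingType.
Local Notation q := (fpsX : {fps R}).
Implicit Types f g : {fps R}.

(** * Coefficients of multiples of powers of [q] *)

Lemma coef_fpsD f g n : (f + g) n = f n + g n.
Proof. by []. Qed.

Lemma coef_fpsXM f n : (q * f) n = if n is m.+1 then f m else 0.
Proof.
rewrite /GRing.mul /= big_ord_recl mul0r add0r.
case: n => [|n]; first by rewrite big_ord0.
rewrite big_ord_recl mul1r big1 ?addr0 ?subSS ?subn0 // => i _.
by rewrite mul0r.
Qed.

Lemma coef_fpsXnM f d n :
  (q ^+ d * f) n = if (d <= n)%N then f (n - d)%N else 0.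
Proof.
elim: d n => [|d IHd] n; first by rewrite expr0 mul1r subn0.
by rewrite exprS -mulrA coef_fpsXM; case: n => // n; rewrite IHd.
Qed.

Lemma coef_fpsXn d n : (q ^+ d) n = (d == n)%:R.
Proof.
rewrite -[q ^+ d]mulr1 coef_fpsXnM /= subn_eq0.
by rewrite eqn_leq; case: leqP.
Qed.

(** * Recurrences for the [q]-series *)

Lemma qpochS l : qpoch q l.+1 = qpoch q l * (1 - q ^+ l.+1).
Proof. by rewrite /qpoch big_ord_recr /= -exprS. Qed.

Definition qcoef (i j : nat) : {fps R} := (qpoch q i * qpoch q j)^-1.

Lemma qcoefC i j : qcoef i j = qcoef j i.
Proof. by rewrite /qcoef mulrC. Qed.

Lemma qcoefSl i j : (1 - q ^+ i.+1) * qcoef i.+1 j = qcoef i j.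
Proof.
(* Invertibility of [(q;q)_(i+1)] forces that of its last factor, which may then be cancelled. *)
have U := unitrM (qpoch q i) (1 - q ^+ i.+1).
rewrite -qpochS qpochX_unit in U; have /andP[Ui Ux] := esym U.
rewrite /qcoef qpochS -mulrA mulrCA [X in _ * X]invrM //; last first.
  by rewrite unitrM Ui qpochX_unit.
by rewrite mulrCA divrr // mulr1.
Qed.

Lemma qcoefSr i j : (1 - q ^+ j.+1) * qcoef i j.+1 = qcoef i j.
Proof. by rewrite qcoefC qcoefSl qcoefC. Qed.

Definition odd_series N : {fps R} := \sum_(i < N.+1) q ^+ i * qcoef i (N - i).
Definition even_series N : {fps R} := \sum_(i < N.+1) qcoef i (N - i).

Lemma qcoef00 : qcoef 0 0 = 1.
Proof. by rewrite /qcoef /qpoch big_ord0 mulr1 invr1. Qed.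

Lemma odd_series0 : odd_series 0 = 1.
Proof. by rewrite /odd_series big_ord1 expr0 mul1r qcoef00. Qed.

Lemma even_series0 : even_series 0 = 1.
Proof. by rewrite /even_series big_ord1 qcoef00. Qed.

Lemma even_seriesS N : even_series N.+1 = even_series N + odd_series N.+1.
Proof.
apply/eqP; rewrite -subr_eq; apply/eqP.
rewrite /even_series /odd_series -sumrB big_ord_recl expr0 mul1r subrr add0r.
by apply: eq_bigr => i _; rewrite lift0 subSS -[RHS]qcoefSl mulrBl mul1r.
Qed.

(** Termwise, [q^i - q^(N+1) = q^i (1 - q^(N+1-i))]: this kills the term [i = N+1] and elsewhere
    cancels the last factor of [(q;q)_(N+1-i)]. *)
Lemma odd_seriesS N :
  odd_series N.+1 = odd_series N + q ^+ N.+1 * even_series N.+1.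
Proof.
apply/eqP; rewrite -subr_eq; apply/eqP.
rewrite /even_series /odd_series mulr_sumr -sumrB big_ord_recr /= subrr addr0.
apply: eq_bigr => i _; have le_iN : (i <= N)%N by rewrite -ltnS.
rewrite subSn // -[in RHS]qcoefSr mulrA mulrBr mulr1 -exprD mulrBl.
by rewrite addnS subnKC.
Qed.

Definition odd_qbinom_sum N : {fps R} := qpoch q N * odd_series N.
(** The Galois number, i.e. the sum of all Gaussian binomials with upper index [N]. *)
Definition even_qbinom_sum N : {fps R} := qpoch q N * even_series N.

Lemma odd_qbinom_sumS N :
  odd_qbinom_sum N.+1 = odd_qbinom_sum N + q ^+ N.+1 * even_qbinom_sum N.
Proof.
rewrite /odd_qbinom_sum /even_qbinom_sum qpochS.
have eA := odd_seriesS N; have eB := even_seriesS N.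
set a := odd_series N.+1 in eA eB *; set x := q ^+ _ in eA eB *.
(* With [b = even_series N], the claim reduces to [(1 - x) a = (a - x (b + a)) + x b]. *)
have -> : odd_series N = a - x * even_series N.+1 by rewrite eA addrK.
by rewrite eB; ring.
Qed.

Lemma even_qbinom_sumS N :
  even_qbinom_sum N.+1 = even_qbinom_sum N + odd_qbinom_sum N.
Proof.
rewrite /odd_qbinom_sum /even_qbinom_sum qpochS.
have eA := odd_seriesS N; have eB := even_seriesS N.
set b := even_series N.+1 in eA eB *; set x := q ^+ _ in eA eB *.
have -> : even_series N = b - odd_series N.+1 by rewrite eB addrK.
by rewrite eA; ring.
Qed.

Lemma qbinom_sumE N :
  \sum_(0 <= i < N.+1) qbinom N i * q ^+ i = odd_qbinom_sum N.
Proof.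
rewrite big_mkord /odd_qbinom_sum mulr_sumr; apply: eq_bigr => i _.
by rewrite /qbinom -ltnS ltn_ord -mulrA [_ * q ^+ i]mulrC.
Qed.

Lemma odd_seriesE N :
  \sum_(0 <= i < N.+1) q ^+ i / (qpoch q i * qpoch q (N - i)) = odd_series N.
Proof. by rewrite big_mkord. Qed.

(** * Counting lists by the value of a statistic *)

Definition level_count (T : eqType) (A : {pred T}) (w : T -> nat) (n : nat)
    (c : R) : Prop :=
  exists s : seq T, [/\ uniq s,
    forall i, (i \in s) = (i \in A) && (w i == n) & c = (size s)%:R].

(** The list enumerating a level set also witnesses summability: as [1 != 0] in [R], the coefficient
    of [q^n] in [q^(w i)] is nonzero exactly when [w i = n]. *)
Lemma has_sum_level_count (T : eqType) (A : {pred T}) (w : T -> nat) (F : {fps R}) :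
  (forall n, level_count A w n (F n)) ->
  fps_has_sum A (fun i => q ^+ w i) F.
Proof.
move=> cF n; have [s [Us memS ->]] := cF n; exists s; split=> // [i|].
  by rewrite memS coef_fpsXn; case: (w i == n); rewrite ?oner_eq0 ?eqxx.
rewrite -sum1_size natr_sum big_seq [RHS]big_seq; apply: eq_bigr => i.
by rewrite memS coef_fpsXn => /andP[_ ->].
Qed.

(** Abstracts the case split on the largest part; the last clause makes the two cases disjoint. *)
Definition extends_by (T : eqType) (x : T) (A A0 A1 : {pred seq T}) : Prop :=
  forall y t, [/\ ([::] \in A) = ([::] \in A0),
    (y :: t \in A) = (y :: t \in A0) || (y == x) && (t \in A1)
    & x :: t \notin A0].

(** The level set of [A] at [n] is that of [A0] at [n] together with [x] prepended to that of [A1]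
    at [n - d]. The guard [d <= n] keeps the subtraction genuine; for [n < d] no new list
    appears. *)
Lemma level_count_extend (T : eqType) (x : T) (A A0 A1 : {pred seq T})
    (w w1 : seq T -> nat) d n c0 (f : {fps R}) :
    extends_by x A A0 A1 -> (forall t, w (x :: t) = d + w1 t)%N ->
    level_count A0 w n c0 ->
    ((d <= n)%N -> level_count A1 w1 (n - d) (f (n - d)%N)) ->
  level_count A w n (c0 + (q ^+ d * f) n).
Proof.
move=> extA wE [s0 [Us0 mem0 ->]] cnt1; rewrite coef_fpsXnM.
have nilA : ([::] \in A) = ([::] \in A0) by case: (extA x [::]).
case: leqP => [le_dn | lt_nd]; last first.
  exists s0; split=> // [[|y t]|]; rewrite ?addr0 // mem0 ?nilA //.
  case: (extA y t) => _ -> _; case: (y =P x) => [->|_] /=; last by rewrite orbF.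
  by rewrite wE (_ : _ == n = false) ?andbF //; lia.
have [s1 [Us1 mem1 ->]] := cnt1 le_dn.
exists (s0 ++ map (cons x) s1); split=> [|[|y t]|]; last 1 first.
- by rewrite size_cat size_map natrD.
- rewrite cat_uniq Us0 map_inj_uniq ?Us1 ?andbT => [|t u [] //].
  apply/hasPn => _ /mapP[t _ ->]; rewrite /= mem0.
  by case: (extA x t) => _ _ /negPf->.
- by rewrite mem_cat mem0 nilA; case: mapP => [[]|] //; rewrite orbF.
rewrite mem_cat mem0; case: (extA y t) => _ -> _; rewrite andb_orl; congr (_ || _).
case: (y =P x) => [->|ne_yx] /=; last by apply/mapP => -[u _ [/ne_yx]].
by rewrite mem_map ?mem1 => [|? ? [] //]; rewrite wE; congr (_ && _); lia.
Qed.

End QSums.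

(** * Prepending a part to a partition *)

Definition even_index_sum (s : seq nat) : nat :=
  (\sum_(i < size s | odd i) nth 0 s i)%N.

Lemma odd_index_sum_cons x s :
  odd_index_sum (x :: s) = (x + even_index_sum s)%N.
Proof.
rewrite /odd_index_sum big_mkcond big_ord_recl /=; congr (_ + _)%N.
rewrite /even_index_sum [RHS]big_mkcond.
by apply: eq_bigr => i _ /=; rewrite negbK.
Qed.

Lemma even_index_sum_cons x s : even_index_sum (x :: s) = odd_index_sum s.
Proof.
rewrite /even_index_sum big_mkcond big_ord_recl /= add0n.
by rewrite /odd_index_sum [RHS]big_mkcond.
Qed.

Lemma is_partition_cons x s :
  is_partition (x :: s) = [&& is_partition s, (0 < x)%N & all (geq x) s].
Proof.
rewrite /is_partition /= path_sortedE; last exact: (rev_trans leq_trans).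
by case: (all (geq x) s); case: sorted; case: ltnP; case: all.
Qed.

Lemma partitions_le_extend N :
  extends_by N.+1 (partitions_le N.+1) (partitions_le N) (partitions_le N.+1).
Proof.
move=> y t; split; rewrite ?inE //=; last by rewrite ltnn andbF.
rewrite !is_partition_cons; case: (is_partition t) => //=; last by rewrite andbF.
case: (ltngtP y N.+1) => [lt_yN|lt_Ny|->] /=.
- have -> : (y <= N)%N by []; rewrite orbF; case: (0 < y)%N => //=.
  (* The tail is bounded by [y <= N], so both bound tests succeed. *)
  case: allP => //= ley; transitivity true; last symmetry;
    apply/allP => z /ley /=; lia.
- have -> : (y <= N)%N = false by lia.
  by rewrite !andbF.
- by rewrite ltnn andbF /= andbb.
Qed.

Lemma distinct_partitions_le_extend N :
  extends_by N.+1 (distinct_partitions_le N.+1) (distinct_partitions_le N)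
    (distinct_partitions_le N).
Proof.
move=> y t; split; rewrite ?inE //=; last by rewrite ltnn !andbF.
rewrite !is_partition_cons; case: (is_partition t) => //=; last by rewrite andbF.
case: (uniq t); rewrite ?andbF ?andbT //=.
case: (ltngtP y N.+1) => [lt_yN|lt_Ny|->] /=.
- have -> : (y <= N)%N by []; rewrite orbF; case: (0 < y)%N => //=.
  case: allP => //= ley; congr (_ && _); transitivity true; last symmetry;
    apply/allP => z /ley /=; lia.
- have -> : (y <= N)%N = false by lia.
  by rewrite !andbF.
(* Distinctness keeps [N+1] out of the tail, sharpening its bound to [N]. *)
- rewrite ltnn !andbF /=; apply/and3P/allP => [[_ notin le] z tz|le].
    have /allP/(_ z tz) := le; have : z != N.+1 by apply: contraNneq notin => <-.
    lia.
  split; [|by apply/negP => /le; rewrite ltnn|]; apply/allP => z /le /=; lia.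
Qed.

Lemma partitions_le0 s : (s \in partitions_le 0) = (s == [::]).
Proof.
case: s => [|x s]; rewrite inE //= is_partition_cons.
by case: x => [|x]; rewrite /= ?andbF.
Qed.

Lemma distinct_partitions_le0 s : (s \in distinct_partitions_le 0) = (s == [::]).
Proof.
case: s => [|x s]; rewrite inE //= is_partition_cons.
by case: x => [|x]; rewrite /= ?andbF.
Qed.

(** * Matching the counts with the series *)

Section Counts.
Variable R : comUnitRingType.

Lemma level_count_nil (T : eqType) (A : {pred seq T}) (w : seq T -> nat) n :
    (forall s, (s \in A) = (s == [::])) -> w [::] = 0%N ->
  level_count A w n ((1 : {fps R}) n).
Proof.
move=> AE w0; exists (if n == 0%N then [:: [::]] else [::]).
split=> [|s|]; [by case: eqP | | by rewrite /=; case: eqP].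
rewrite AE; case: s => [|x s] /=; last by case: ifP.
by rewrite w0 eq_sym; case: eqP.
Qed.

Lemma odd_index_sum0 : odd_index_sum [::] = 0%N.
Proof. by rewrite /odd_index_sum big_ord0. Qed.

Lemma even_index_sum0 : even_index_sum [::] = 0%N.
Proof. by rewrite /even_index_sum big_ord0. Qed.

Lemma distinct_level_count N n :
  level_count (distinct_partitions_le N) odd_index_sum n
    (odd_qbinom_sum R N n) /\
  level_count (distinct_partitions_le N) even_index_sum n
    (even_qbinom_sum R N n).
Proof.
elim: N n => [|N IHN] n.
  rewrite /odd_qbinom_sum /even_qbinom_sum odd_series0 even_series0.
  rewrite /qpoch big_ord0 mulr1.
  by split; apply: level_count_nil; rewrite ?odd_index_sum0 ?even_index_sum0 //;
    apply: distinct_partitions_le0.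
have ext := @distinct_partitions_le_extend N.
have [cO cE] := IHN n; split.
  rewrite odd_qbinom_sumS coef_fpsD.
  apply: (level_count_extend ext (odd_index_sum_cons _) cO) => _.
  by case: (IHN (n - N.+1)%N).
(* The prepended part adds nothing to the even-position sum, hence a shift by [q^0]. *)
rewrite even_qbinom_sumS coef_fpsD -[odd_qbinom_sum R N]mul1r -(expr0 fpsX).
apply: (level_count_extend (d := 0) (w1 := odd_index_sum) ext
  (even_index_sum_cons _) cE) => _.
by case: (IHN (n - 0)%N).
Qed.

Lemma partitions_level_count N n :
  level_count (partitions_le N) odd_index_sum n (odd_series R N n) /\
  level_count (partitions_le N) even_index_sum n (even_series R N n).
Proof.
elim: N n => [|N IHN] n.
  rewrite odd_series0 even_series0.
  by split; apply: level_count_nil; rewrite ?odd_index_sum0 ?even_index_sum0 //;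
    apply: partitions_le0.
have ext := @partitions_le_extend N.
(* The recurrences have [N+1] on both sides, so an inner strong induction on [n] is used: the odd
   count calls the even one at [n - (N+1) < n], and the even count then calls the odd one at the
   same [n]. *)
elim/ltn_ind: n => n IHn; have [cO cE] := IHN n.
have cO' : level_count (partitions_le N.+1) odd_index_sum n (odd_series R N.+1 n).
  rewrite odd_seriesS coef_fpsD.
  apply: (level_count_extend ext (odd_index_sum_cons _) cO) => le_Nn.
  by case: (IHn (n - N.+1)%N) => //; lia.
split=> //; rewrite even_seriesS coef_fpsD -[odd_series R N.+1]mul1r -(expr0 fpsX).
by apply: (level_count_extend (d := 0) (w1 := odd_index_sum) ext
  (even_index_sum_cons _) cE) => _; rewrite subn0.
Qed.

End Counts.

Theorem theorem3p2 (N : nat) :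
  fps_has_sum (distinct_partitions_le N)
    (fun s => (fpsX : {fps int}) ^+ odd_index_sum s)
    (\sum_(0 <= i < N.+1) qbinom N i * fpsX ^+ i)
  /\
  fps_has_sum (partitions_le N)
    (fun s => (fpsX : {fps int}) ^+ odd_index_sum s)
    (\sum_(0 <= i < N.+1) fpsX ^+ i / (qpoch fpsX i * qpoch fpsX (N - i))).
Proof.
rewrite qbinom_sumE odd_seriesE; split; apply: has_sum_level_count => n.
  by case: (distinct_level_count int N n).
by case: (partitions_level_count int N n).
Qed.
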